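(* Let $r_1,\ldots,r_m$ and $c_1,\ldots,c_n$ be positive integers such that $r_1+\cdots+r_m=c_1+\cdots+c_n=N$, and let $W=(w_{ij})$ be a non-negative $m\times n$ matrix. Construct an $N\times N$ matrix $A$ as follows. Represent the set of rows of $A$ as a disjoint union of $m$ subsets $R_1,\ldots,R_m$ with $|R_i|=r_i$ for $i=1,\ldots,m$, and the set of columns of $A$ as a disjoint union of $n$ subsets $C_1,\ldots,C_n$ with $|C_j|=c_j$ for $j=1,\ldots,n$, so that $A$ is split into $mn$ blocks $R_i\times C_j$. Let every entry of $A$ in the block $R_i\times C_j$ be equal to $w_{ij}$. Then the total weight of the $m\times n$ contingency tables with row sums $r_1,\ldots,r_m$ and column sums $c_1,\ldots,c_n$, where the table $D=(d_{ij})$ is counted with the weight $$\prod_{i,j}\frac{w_{ij}^{d_{ij}}}{d_{ij}!},$$ is equal to $$\frac{\operatorname{per}A}{r_1!\cdots r_m!\,c_1!\cdots c_n!}.$$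
   Context: An $m\times n$ contingency table with row sums $r_1,\ldots,r_m$ and column sums $c_1,\ldots,c_n$ is an $m\times n$ matrix with non-negative integer entries having these row and column sums. The permanent of an $N\times N$ matrix $A=(a_{ij})$ is $\operatorname{per}A=\sum_{\sigma\in S_N}\prod_{i=1}^N a_{i\sigma(i)}$, where $S_N$ is the symmetric group on $\{1,\ldots,N\}$. The convention $0^0=1$ is used. *)

(* Defs.v *)
From mathcomp Require Import all_boot all_order all_fingroup all_algebra.

Set Implicit Arguments.
Unset Strict Implicit.
Unset Printing Implicit Defensive.

Import Order.TTheory GRing.Theory Num.Theory.
Local Open Scope ring_scope.

Definition permanent (R : pzRingType) (N : nat) (A : 'M[R]_N) : R :=
  \sum_(s : 'S_N) \prod_(i < N) A i (s i).

Definition split_into (N k : nat) (B : 'I_k -> {set 'I_N}) (s : 'I_k -> nat) :=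
  [/\ \bigcup_i B i = [set: 'I_N],
      forall i j, i != j -> [disjoint B i & B j]
    & forall i, #|B i| = s i].

Definition contingency_table (m n : nat) (r : 'I_m -> nat) (c : 'I_n -> nat)
    (D : 'M[nat]_(m, n)) : bool :=
  [forall i, (\sum_j D i j)%N == r i] && [forall j, (\sum_i D i j)%N == c j].

(* [W i j ^+ 0] is 1 even when [W i j = 0]. *)
Definition table_weight (R : fieldType) (m n : nat) (W : 'M[R]_(m, n))
    (D : 'M[nat]_(m, n)) : R :=
  \prod_i \prod_j (W i j ^+ D i j / (D i j)`!%:R).

(* Tables over ['I_(\sum_i r i).+1] form a finite type, so they can index a
   sum; no contingency table is lost or counted twice, since its entries are
   at most the sum of all the [r i] (see [contingency_table_bounded]). *)
Definition nat_table (m n b : nat) (D : 'M['I_b]_(m, n)) : 'M[nat]_(m, n) :=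
  map_mx (@nat_of_ord b) D.

Definition total_weight (R : fieldType) (m n : nat) (r : 'I_m -> nat)
    (c : 'I_n -> nat) (W : 'M[R]_(m, n)) : R :=
  \sum_(D : 'M['I_(\sum_i r i).+1]_(m, n) | contingency_table r c (nat_table D))
    table_weight W (nat_table D).

Lemma contingency_table_bounded (m n : nat) (r : 'I_m -> nat) (c : 'I_n -> nat)
    (D : 'M[nat]_(m, n)) :
  contingency_table r c D ->
  exists! D' : 'M['I_(\sum_i r i).+1]_(m, n), nat_table D' = D.
Proof.
case/andP=> /forallP rD _.
have leD i j : (D i j <= \sum_i r i)%N.
  rewrite (bigD1 i) //= -(eqP (rD i)) (bigD1 j) //= -addnA; exact: leq_addr.
exists (\matrix_(i, j) inord (D i j)); split=> [|D' <-].
  by apply/matrixP=> i j; rewrite !mxE inordK // ltnS.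
by apply/matrixP=> i j; rewrite !mxE inord_val.
Qed.

(* Main.v *)
(* Write f and g for the maps sending a row, resp. a column, of A to the index
   of its block. The term of per A at s depends only on the table D_s whose
   (i, j) entry counts the rows k with (f k, g (s k)) = (i, j), so it suffices
   to show that each table D arises from prod r_i! prod c_j! / prod d_ij!
   permutations s. Fix p : 'I_N -> 'I_m * 'I_n taking each value (i, j) exactly
   d_ij times, and count in two ways the pairs (s, q) with p o q = (f, g o s).
   Given s, there are prod d_ij! such q if D_s = D and none otherwise. In the
   other order, q must satisfy p.1 o q = f, which has prod r_i! solutions, and
   then s must satisfy g o s = p.2 o q, which has prod c_j! solutions. *)
Require Import Defs.
From mathcomp Require Import all_boot all_order all_fingroup all_algebra.

Set Implicit Arguments.
Unset Strict Implicit.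
Unset Printing Implicit Defensive.

Import Order.TTheory GRing.Theory Num.Theory.
Local Open Scope ring_scope.

(** * Permutations that preserve the fibers of a map *)

Section FiberPermutations.

Variables (T U : finType) (F : T -> U).

Let fiber u := [set x | F x == u].

(** The list [vs] serves an induction that frees the fibers one at a time; once it lists all of [U],
    this is the whole stabilizer of [F]. *)
Definition fiber_stab (vs : seq U) : {set {perm T}} :=
  [set s : {perm T} |
    [forall x, (F (s x) == F x) && ((F x \in vs) || (s x == x))]].

Lemma fiber_stabP (vs : seq U) (s : {perm T}) :
  reflect (forall x, F (s x) = F x /\ (F x \notin vs -> s x = x))
    (s \in fiber_stab vs).
Proof.
rewrite inE; apply: (iffP forallP) => sP x.
  by have /andP[/eqP-> /orP[-> // | /eqP->]] := sP x.
by have [-> sx] := sP x; rewrite eqxx /=; case: (F x \in vs) sx => //= ->.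
Qed.

Lemma fiber_stab_group_set (vs : seq U) : group_set (fiber_stab vs).
Proof.
apply/group_setP; split=> [|s t /fiber_stabP sP /fiber_stabP tP].
  by apply/fiber_stabP=> x; rewrite perm1.
apply/fiber_stabP=> x; rewrite permM; have [Fs sx] := sP x.
have [-> _] := tP (s x); split=> // vsx.
by rewrite sx //; case: (tP x) => _; apply.
Qed.

Canonical fiber_stab_group (vs : seq U) := Group (fiber_stab_group_set vs).

Lemma fiber_stab_cons (u : U) (vs : seq U) :
  (Sym (fiber u) * fiber_stab vs)%g = fiber_stab (u :: vs).
Proof.
apply/setP=> s; apply/mulsgP/fiber_stabP.
  case=> p q; rewrite inE => pP /fiber_stabP qP -> x; rewrite permM.
  have [-> qx] := qP (p x).
  have Fp : F (p x) = F x.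
    case Fx: (F x == u).
      have := perm_closed x pP; rewrite !inE Fx => /eqP->.
      by rewrite (eqP Fx).
    by rewrite (out_perm pP) // inE Fx.
  split=> // ; rewrite inE negb_or => /andP[Fx vsx].
  by rewrite qx ?Fp // (out_perm pP) // inE.
(* The first factor is [s] on the fiber of [u] and the identity elsewhere. Since [s] maps this fiber
   to itself, the second factor [p^-1 * s] fixes it pointwise. *)
move=> sP; pose p := restr_perm (fiber u) s.
have sN : s \in 'N(fiber u | 'P)%g.
  by apply/astabsP=> x; rewrite !inE /= apermE; case: (sP x) => ->.
have pP : perm_on (fiber u) p := restr_perm_on _ _.
exists p (p^-1 * s)%g; rewrite ?mulKVg // ?[p \in _]inE //.
apply/fiber_stabP=> x; rewrite permM.
case Fx: (x \in fiber u).
  have -> : s (p^-1%g x) = x.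
    rewrite -(restr_permE sN) -/p ?permKV //.
    by rewrite (perm_closed x (perm_onV pP)).
  by [].
rewrite (out_perm (perm_onV pP)) ?Fx //; case: (sP x) => -> sx.
split=> // vsx; apply: sx; rewrite inE negb_or vsx andbT.
by rewrite inE in Fx; rewrite Fx.
Qed.

Lemma card_fiber_stab (vs : seq U) :
  uniq vs -> #|fiber_stab vs| = (\prod_(u <- vs) #|fiber u|`!)%N.
Proof.
elim: vs => [_|u vs IH /= /andP[vsu uvs]].
  rewrite big_nil; apply/eqP/cards1P; exists 1%g; apply/setP=> s; rewrite inE.
  apply/fiber_stabP/eqP=> [sP|-> x]; last by rewrite perm1.
  by apply/permP=> x; rewrite perm1; case: (sP x) => _; apply.
(* The cardinals multiply because the two factors meet trivially: as [u] is not in [vs], an element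
   of [fiber_stab vs] fixes the fiber of [u], while an element of the symmetric group fixes
   everything else. *)
rewrite big_cons -IH // -fiber_stab_cons TI_cardMg ?card_Sym //.
apply/trivgP/subsetP=> s; rewrite !inE => /andP[sS] sP.
have /fiber_stabP {}sP : s \in fiber_stab vs by rewrite inE.
apply/eqP/permP=> x; rewrite perm1; case Fx: (x \in fiber u).
  by case: (sP x) => _; apply; rewrite inE in Fx; rewrite (eqP Fx).
by rewrite (out_perm sS) ?Fx.
Qed.

End FiberPermutations.

(** * Maps and permutations with prescribed fibers *)

Lemma card_fiber_perm (T : finType) (U : eqType) (F : T -> U) (s : {perm T})
    (u : U) :
  #|[set x | F (s x) == u]| = #|[set x | F x == u]|.
Proof.
rewrite -[RHS](card_imset _ (@perm_inj _ s^-1)); apply: eq_card => x.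
rewrite inE; apply/idP/imsetP=> [Fx|[y + ->]]; last by rewrite inE permKV.
by exists (s x); rewrite ?inE ?permK.
Qed.

Lemma count_mem_codom (N : nat) (U : eqType) (F : 'I_N -> U) (u : U) :
  count_mem u [tuple F k | k < N] = #|[set k | F k == u]|.
Proof.
rewrite -sum1_count big_tuple -sum1_card; apply: eq_bigl => k.
by rewrite tnth_mktuple inE.
Qed.

(* The solutions s of G \o s = F form a coset of the stabilizer of F, once
   there is one. *)
Lemma card_perm_comp (N : nat) (U : finType) (F G : 'I_N -> U) :
    (forall u, #|[set k | F k == u]| = #|[set k | G k == u]|) ->
  #|[set s : 'S_N | [forall k, G (s k) == F k]]|
    = (\prod_u #|[set k | F k == u]|`!)%N.
Proof.
move=> FG.
(* One solution [s0] exists because the lists of values of [F] and [G] have equal multiplicities. *)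
have /tuple_permP[s0 /val_inj s0P] :
    perm_eq [tuple F k | k < N] [tuple G k | k < N].
  by apply/allP=> u _; rewrite /= !count_mem_codom FG.
have Gs0 k : G (s0 k) = F k.
  by move/(congr1 (fun t => tnth t k)): s0P; rewrite !tnth_mktuple.
transitivity #|fiber_stab F (index_enum U)|; last first.
  by rewrite card_fiber_stab ?index_enum_uniq.
rewrite -[RHS](card_rcoset _ s0); apply: eq_card => s.
have Fs k : F ((s * s0^-1)%g k) = G (s k) by rewrite -Gs0 permM permKV.
rewrite mem_rcoset inE; apply/forallP/fiber_stabP=> sP k.
  by rewrite Fs (eqP (sP k)) mem_index_enum.
by have [] := sP k; rewrite Fs => ->.
Qed.

(** The list that repeats each [u] exactly [d u] times has length [N]; its indexing function is
    [p]. *)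
Lemma ex_fun_fibers (N : nat) (U : finType) (d : U -> nat) :
    (\sum_u d u)%N = N ->
  exists p : 'I_N -> U, forall u, #|[set k | p k == u]| = d u.
Proof.
move=> sum_d; pose t := flatten [seq nseq (d u) u | u <- index_enum U].
have t_count v : count_mem v t = d v.
  rewrite count_flatten -map_comp sumnE big_map.
  rewrite (bigD1_seq v) ?index_enum_uniq ?mem_index_enum //= count_nseq /= eqxx.
  rewrite mul1n big1 ?addn0 // => u /negPf uv.
  by rewrite count_nseq /= uv.
have t_size : size t == N.
  rewrite size_flatten /shape -map_comp sumnE big_map -sum_d.
  by apply/eqP/eq_bigr=> u _; rewrite /= size_nseq.
exists (tnth (Tuple t_size)) => u; rewrite -t_count -sum1_card.
rewrite -sum1_count -[t]/(val (Tuple t_size)) big_tuple.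
by apply: eq_bigl => k; rewrite inE.
Qed.

Lemma card_fiber_fst (N : nat) (X Y : finType) (p : 'I_N -> X * Y) (x : X) :
  #|[set k | (p k).1 == x]| = (\sum_y #|[set k | p k == (x, y)]|)%N.
Proof.
rewrite -sum1_card (partition_big (fun k => (p k).2) predT) //=.
apply: eq_bigr => y _; rewrite -sum1_card; apply: eq_bigl => k.
by rewrite !inE; case: (p k).
Qed.

Lemma card_fiber_snd (N : nat) (X Y : finType) (p : 'I_N -> X * Y) (y : Y) :
  #|[set k | (p k).2 == y]| = (\sum_x #|[set k | p k == (x, y)]|)%N.
Proof.
rewrite -sum1_card (partition_big (fun k => (p k).1) predT) //=.
apply: eq_bigr => x _; rewrite -sum1_card; apply: eq_bigl => k.
by rewrite !inE andbC; case: (p k).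
Qed.

(** * The table of a permutation *)

Section ContingencyTables.

Variables (m n N : nat) (r : 'I_m -> nat) (c : 'I_n -> nat).
Variables (f : 'I_N -> 'I_m) (g : 'I_N -> 'I_n).
Hypothesis f_fiber : forall i, #|[set k | f k == i]| = r i.
Hypothesis g_fiber : forall j, #|[set l | g l == j]| = c j.

Definition perm_table (s : 'S_N) : 'M[nat]_(m, n) :=
  \matrix_(i, j) #|[set k | (f k, g (s k)) == (i, j)]|.

Lemma perm_table_contingency (s : 'S_N) : contingency_table r c (perm_table s).
Proof.
apply/andP; split; [apply/forallP=> i | apply/forallP=> j].
  rewrite -f_fiber (card_fiber_fst (fun k => (f k, g (s k)))).
  by apply/eqP/eq_bigr=> j _; rewrite mxE.
rewrite -g_fiber -(card_fiber_perm g s).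
rewrite (card_fiber_snd (fun k => (f k, g (s k)))).
by apply/eqP/eq_bigr=> i _; rewrite mxE.
Qed.

Lemma card_perm_table (D : 'M[nat]_(m, n)) :
    contingency_table r c D ->
  (#|[set s | perm_table s == D]| * \prod_i \prod_j (D i j)`!
    = (\prod_i (r i)`!) * (\prod_j (c j)`!))%N.
Proof.
case/andP=> /forallP rD /forallP cD.
(* The row sums of [D] are the sizes of the fibers of [f], which partition ['I_N]. *)
have sumD : (\sum_(u : 'I_m * 'I_n) D u.1 u.2)%N = N.
  rewrite -(pair_bigA _ (fun i j => D i j)) /=.
  rewrite (eq_bigr (fun i => #|[set k | f k == i]|)) => [|i _].
    rewrite -[RHS]card_ord -sum1_card (partition_big f predT) //=.
    by apply: eq_bigr => i _; rewrite sum1dep_card.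
  by rewrite f_fiber (eqP (rD i)).
have [p pD] := ex_fun_fibers sumD.
have p1 i : #|[set k | (p k).1 == i]| = r i.
  rewrite card_fiber_fst -(eqP (rD i)).
  by apply: eq_bigr => j _; rewrite pD.
have p2 j : #|[set k | (p k).2 == j]| = c j.
  rewrite card_fiber_snd -(eqP (cD j)).
  by apply: eq_bigr => i _; rewrite pD.
pose E (s q : 'S_N) := [forall k, p (q k) == (f k, g (s k))].
have E_table s q : E s q -> perm_table s = D.
  move/forallP=> Esq; apply/matrixP=> i j; rewrite mxE -(pD (i, j)).
  rewrite -(card_fiber_perm p q); apply: eq_card => k.
  by rewrite !inE (eqP (Esq k)).
(* Only the second condition involves [s], so [q] can be chosen first. *)
have E_split s q : E s q =
    [forall k, (p (q k)).1 == f k] && [forall k, g (s k) == (p (q k)).2].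
  apply/forallP/andP=> [Esq|[/forallP q1 /forallP q2] k].
    by split; apply/forallP=> k; rewrite (eqP (Esq k)).
  by rewrite (eqP (q2 k)) -(eqP (q1 k)) -surjective_pairing.
transitivity (\sum_(s : 'S_N) \sum_(q : 'S_N | E s q) 1)%N.
  rewrite [RHS](bigID (mem [set s | perm_table s == D])) /=.
  rewrite [X in (_ + X)%N]big1 ?addn0 => [|s]; last first.
    rewrite inE => sD; rewrite big_pred0 // => q.
    by apply/negP=> /E_table /eqP; apply/negP.
  rewrite -sum_nat_const; apply: eq_bigr => s; rewrite inE => /eqP sD.
  (* For fixed [s] with table [D], the maps [p] and [(f, g o s)] both have fibers of sizes
     [D i j]. *)
  rewrite sum1dep_card card_perm_comp => [|[i j]].
    rewrite pair_bigA; apply: eq_bigr => [[i j]] _ /=.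
    by rewrite -sD mxE.
  by rewrite pD -sD mxE.
rewrite (exchange_big_dep predT) //=.
transitivity (\sum_(q : 'S_N | [forall k, (p (q k)).1 == f k])
                \prod_j (c j)`!)%N; last first.
  rewrite sum_nat_const; congr (_ * _)%N.
  rewrite -(eq_bigr _ (fun i _ => congr1 factorial (f_fiber i))).
  rewrite -(card_perm_comp (G := fun k => (p k).1)) => [|i].
    by apply: eq_card => q; rewrite inE.
  by rewrite f_fiber p1.
rewrite [LHS](bigID (fun q : 'S_N => [forall k, (p (q k)).1 == f k])) /=.
rewrite [X in (_ + X)%N]big1 ?addn0 => [|q /negPf q1]; last first.
  by rewrite big_pred0 // => s; rewrite E_split q1.
apply: eq_bigr => q q1.
have pq2 j : #|[set k | (p (q k)).2 == j]| = c j.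
  by rewrite (card_fiber_perm (fun k => (p k).2)) p2.
rewrite -(eq_bigr _ (fun j _ => congr1 factorial (pq2 j))).
rewrite -(card_perm_comp (G := g)) => [|j]; last by rewrite g_fiber pq2.
by rewrite sum1dep_card; apply: eq_card => s; rewrite !inE E_split q1.
Qed.

Lemma perm_table_prod (R : comPzRingType) (W : 'M[R]_(m, n)) (s : 'S_N) :
  \prod_k W (f k) (g (s k)) = \prod_i \prod_j W i j ^+ perm_table s i j.
Proof.
rewrite pair_bigA (partition_big (fun k => (f k, g (s k))) predT) //=.
apply: eq_bigr => [[i j]] _ /=; rewrite mxE -prodr_const.
by apply: eq_big => [k|k /eqP[-> ->] //]; rewrite inE.
Qed.

End ContingencyTables.

(** * From blocks of the matrix to the weighted sum *)

Lemma split_into_index (N k : nat) (B : 'I_k -> {set 'I_N}) (b : 'I_k -> nat) :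
    split_into B b ->
  exists f : 'I_N -> 'I_k,
    (forall x, x \in B (f x)) /\ (forall i, #|[set x | f x == i]| = b i).
Proof.
case=> covB disB cardB.
have [f fB] : exists f : 'I_N -> 'I_k, forall x, x \in B (f x).
  apply: (fin_all_exists (P := fun x i => x \in B i)) => x.
  have /bigcupP[i _ xBi] : x \in \bigcup_i B i by rewrite covB inE.
  by exists i.
exists f; split=> // i; rewrite -cardB; apply: eq_card => x; rewrite inE.
apply/eqP/idP=> [<- //|xBi]; apply/eqP/negPn/negP=> /disB /disjointFr.
by move/(_ x (fB x)); rewrite xBi.
Qed.

Theorem theorem1p7 (R : realFieldType) (m n N : nat)
    (r : 'I_m -> nat) (c : 'I_n -> nat)
    (r_gt0 : forall i, (0 < r i)%N) (c_gt0 : forall j, (0 < c j)%N)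
    (sum_r : (\sum_i r i)%N = N) (sum_c : (\sum_j c j)%N = N)
    (W : 'M[R]_(m, n)) (W_ge0 : forall i j, 0 <= W i j)
    (Rows : 'I_m -> {set 'I_N}) (Cols : 'I_n -> {set 'I_N})
    (splitR : split_into Rows r) (splitC : split_into Cols c)
    (A : 'M[R]_N)
    (A_block : forall i j k l, k \in Rows i -> l \in Cols j -> A k l = W i j) :
  total_weight r c W =
    permanent A / ((\prod_i (r i)`!%:R) * (\prod_j (c j)`!%:R)).
Proof.
have [f [fRows f_fiber]] := split_into_index splitR.
have [g [gCols g_fiber]] := split_into_index splitC.
have fact_neq0 k : k`!%:R != 0 :> R by rewrite pnatr_eq0 -lt0n fact_gt0.
have prod_fact_neq0 k (b : 'I_k -> nat) : \prod_i (b i)`!%:R != 0 :> R.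
  by apply/prodf_neq0=> i _.
pose tab (s : 'S_N) : 'M['I_(\sum_i r i).+1]_(m, n) :=
  \matrix_(i, j) inord (perm_table f g s i j).
have contP s := perm_table_contingency f_fiber g_fiber s.
have tabK s : nat_table (tab s) = perm_table f g s.
  have [D' [D'P _]] := contingency_table_bounded (contP s).
  (* Outside its range [inord] returns a default value; the entries here are in range, being those
     of the bounded table [D']. *)
  by apply/matrixP=> i j; rewrite /tab -D'P !mxE inordK.
have nat_table_inj : injective (@nat_table m n (\sum_i r i).+1).
  move=> D D' /matrixP DD'; apply/matrixP=> i j; apply: val_inj.
  by have := DD' i j; rewrite !mxE.
apply: (canRL (mulfK _)); first by rewrite mulf_neq0.
(* The permutations are grouped by their tables, and the two sides are compared table by table. *)
rewrite /permanent (partition_big tab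
  (fun D => contingency_table r c (nat_table D))) /=; last first.
  by move=> s _; rewrite tabK.
rewrite mulr_suml; apply: eq_bigr => D DP.
set D0 := nat_table D in DP *.
pose w := \prod_i \prod_j W i j ^+ D0 i j.
pose z : R := \prod_i \prod_j (D0 i j)`!%:R.
have wP s : tab s == D -> \prod_k A k (s k) = w.
  move/eqP=> sD; rewrite /w /D0 -sD tabK -perm_table_prod.
  by apply: eq_bigr => k _; apply: A_block.
have zP : ((\prod_i \prod_j (D0 i j)`!)%N)%:R = z.
  by rewrite natr_prod; apply: eq_bigr => i _; rewrite natr_prod.
have -> : table_weight W D0 = w / z.
  by rewrite -prodf_div; apply: eq_bigr => i _; rewrite prodf_div.
rewrite (eq_bigr _ wP) sumr_const -mulr_natr.
have -> : #|[pred s | tab s == D]| = #|[set s | perm_table f g s == D0]|.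
  by apply: eq_card => s; rewrite !inE -(inj_eq nat_table_inj) tabK.
(* Cast into [R], the double count turns the product of row and column factorials into the number of
   permutations with table [D0] times [z], and [z] cancels. *)
have := congr1 (fun k => k%:R : R) (card_perm_table f_fiber g_fiber DP).
rewrite !natrM zP !natr_prod => <-.
have z_neq0 : z != 0 by apply/prodf_neq0=> i _; apply: prod_fact_neq0.
by rewrite [_%:R * z]mulrC mulrA divfK.
Qed.
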